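(* For every $p>0$ there exist a domain $U\subset\mathbb{C}$ and a sequence of domains $(U_n)_{n\ge1}$ in $\mathbb{C}$, all containing the origin, such that $(U_n)_{n\ge1}$ converges to $U$ in the $p$-Brownian sense while $$d_H(\partial U_n,\partial U)\not\to0\qquad(n\to\infty).$$
   Context: A domain is a nonempty connected open proper subset of $\mathbb{C}$. $(Z_t)_{t\ge0}$ denotes a standard planar Brownian motion started at $0$, and for a domain $D\ni0$, $\tau_D:=\inf\{t\ge0: Z_t\notin D\}$. $p$-Brownian convergence ($p>0$): a sequence of domains $(U_n)$ containing $0$ converges to a domain $U\ni0$ in the $p$-Brownian sense if for each $n$ there exist two random vectors $(\xi_n,\theta_n)$ and $(\xi,\theta)$ on a common probability space such that $(\xi_n,\theta_n)$ has the law of the exit pair $(Z_{\tau_{U_n}},\tau_{U_n})$, $(\xi,\theta)$ has the law of $(Z_{\tau_U},\tau_U)$, and $\mathbf{E}(|\xi_n-\xi|^p)+\mathbf{E}(|\theta_n-\theta|^{p/2})\to0$ as $n\to\infty$. The Hausdorff distance between subsets $A,B\subset\mathbb{C}$ is $d_H(A,B)=\max\left(\sup_{a\in A}\operatorname{dist}(a,B),\ \sup_{b\in B}\operatorname{dist}(b,A)\right)$. *)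

(* Defs.v *)
From HB Require Import structures.
From mathcomp Require Import all_boot all_order all_algebra.
From mathcomp Require Import all_classical all_reals all_analysis.
From mathcomp Require Import measurable_realfun.

Set Implicit Arguments.
Unset Strict Implicit.
Unset Printing Implicit Defensive.

Import Order.TTheory GRing.Theory Num.Theory.
Import numFieldNormedType.Exports.

Local Open Scope classical_set_scope.
Local Open Scope ring_scope.

(* The complex plane is [R * R]; its product topology and product sigma-algebra
   are the usual ones, but the library norm [`|z|] on a product is the sup norm,
   so the modulus is defined here. *)
Definition cmod (R : realType) (z : R * R) : R :=
  Num.sqrt (z.1 ^+ 2 + z.2 ^+ 2).

Definition domain (R : realType) (U : set (R * R)) : Prop :=
  [/\ U !=set0, connected U, open U & U != setT].

Definition boundary (T : topologicalType) (A : set T) : set T :=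
  closure A `\` interior A.

Definition dist_to (R : realType) (a : R * R) (B : set (R * R)) : \bar R :=
  ereal_inf [set (cmod (a - b))%:E | b in B].

(* The value may be [+oo]; for empty [A] or [B] it is not meaningful, but the
   boundary of a domain is never empty. *)
Definition hausdorff_dist (R : realType) (A B : set (R * R)) : \bar R :=
  maxe (ereal_sup [set dist_to a B | a in A])
       (ereal_sup [set dist_to b A | b in B]).

(* Only the times [0 <= t] are meaningful. The second argument of [normal_prob]
   is the standard deviation. *)
Record planar_brownian (R : realType) (d : measure_display)
    (T : measurableType d) (P : probability T R) (Z : R -> T -> R * R) : Prop :=
  PlanarBrownian {
    pb_measurable : forall t : R, 0 <= t -> measurable_fun [set: T] (Z t) ;
    pb_start : forall w, Z 0 w = (0, 0) ;
    pb_continuous : forall w, {within `[0, +oo[, continuous (fun t => Z t w)} ;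
    pb_normal : forall s t : R, 0 <= s -> s < t ->
      forall A : set (R * R), measurable A ->
        P ((fun w => Z t w - Z s w) @^-1` A)
        = (normal_prob 0 (Num.sqrt (t - s))
             \x normal_prob 0 (Num.sqrt (t - s)))%E A ;
    pb_independent : forall (n : nat) (t : nat -> R),
      0 <= t 0%N -> (forall i, t i <= t i.+1) ->
      forall A : nat -> set (R * R), (forall i, measurable (A i)) ->
        P (\bigcap_(i in `I_n) ((fun w => Z (t i.+1) w - Z (t i) w) @^-1` A i))
        = (\prod_(i < n)
             P ((fun w => Z (t i.+1) w - Z (t i) w)%R @^-1` A i))%E
  }.

Definition exit_time (R : realType) (T : Type) (Z : R -> T -> R * R)
    (U : set (R * R)) (w : T) : \bar R :=
  ereal_inf [set t%:E | t in [set t : R | 0 <= t /\ ~ U (Z t w)]].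

(* Where the exit time is [+oo] the first component is the junk value [Z 0 w];
   this case is excluded with probability one by [ec_law1] and [ec_law2]. *)
Definition exit_pair (R : realType) (T : Type) (Z : R -> T -> R * R)
    (U : set (R * R)) (w : T) : (R * R) * \bar R :=
  (Z (fine (exit_time Z U w)) w, exit_time Z U w).

(* The coupled times are real-valued, so equality in law with the exit pair (a
   law on [(R * R) * \bar R]) forces the exit time to be finite almost surely. *)
Record exit_coupling (R : realType) (d : measure_display)
    (T : measurableType d) (P : probability T R) (Z : R -> T -> R * R)
    (V U : set (R * R)) := ExitCoupling {
  ec_disp : measure_display ;
  ec_space : measurableType ec_disp ;
  ec_prob : probability ec_space R ;
  ec_xi1 : ec_space -> R * R ;
  ec_theta1 : ec_space -> R ;
  ec_xi2 : ec_space -> R * R ;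
  ec_theta2 : ec_space -> R ;
  ec_meas_xi1 : measurable_fun setT ec_xi1 ;
  ec_meas_theta1 : measurable_fun setT ec_theta1 ;
  ec_meas_xi2 : measurable_fun setT ec_xi2 ;
  ec_meas_theta2 : measurable_fun setT ec_theta2 ;
  ec_law1 : forall A : set ((R * R) * \bar R), measurable A ->
    ec_prob ((fun w => (ec_xi1 w, (ec_theta1 w)%:E)) @^-1` A)
    = P (exit_pair Z V @^-1` A) ;
  ec_law2 : forall A : set ((R * R) * \bar R), measurable A ->
    ec_prob ((fun w => (ec_xi2 w, (ec_theta2 w)%:E)) @^-1` A)
    = P (exit_pair Z U @^-1` A)
}.

Definition coupling_cost (R : realType) (d : measure_display)
    (T : measurableType d) (P : probability T R) (Z : R -> T -> R * R)
    (V U : set (R * R)) (p : R) (C : exit_coupling P Z V U) : \bar R :=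
  ('E_(ec_prob C)[(fun w => cmod (ec_xi1 w - ec_xi2 w) `^ p)%R]
   + 'E_(ec_prob C)[(fun w => `|ec_theta1 w - ec_theta2 w| `^ (p / 2))%R])%E.

(* All planar Brownian motions have the same law; the convergence is required
   for each of them, whatever the probability space carrying it. *)
Definition p_brownian_cvg (R : realType) (p : R) (U_ : nat -> set (R * R))
    (U : set (R * R)) : Prop :=
  forall (d : measure_display) (T : measurableType d) (P : probability T R)
         (Z : R -> T -> R * R),
    planar_brownian P Z ->
    exists C : forall n, exit_coupling P Z (U_ n) U,
      coupling_cost p (C n) @[n --> \oo] --> 0%E.

(* Main.v *)
Require Import Defs.
From mathcomp Require Import all_boot all_order all_algebra.
From mathcomp Require Import all_classical all_reals all_analysis.
From mathcomp Require Import measurable_realfun lra.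
Import numFieldNormedType.Exports.
Local Open Scope classical_set_scope.
Local Open Scope ring_scope.

Set Implicit Arguments.
Unset Strict Implicit.
Unset Printing Implicit Defensive.
Import Order.TTheory GRing.Theory Num.Theory.

(** The limit domain is the square [U = (-1, 1) x (-1, 1)], and [U_ n] is [U] with
    a bump attached: the thin rectangle [(0, 2) x (1/(n+2), 1/(n+1))]. The tip of
    the bump, at abscissa [2], is a boundary point of [U_ n] at distance at least
    [1] from the boundary of [U], so the Hausdorff distance of the boundaries stays
    at least [1] ([hausdorff_bumped_square]).

    For the convergence the two exit pairs are realised by the same Brownian path.
    They agree unless the exit position from [U] belongs to the bump. These events
    [A n] are pairwise disjoint because the bumps are, so their probabilities are
    summable and tend to zero: no estimate of harmonic measure is needed. On [A n]
    the distance of the exit positions is bounded, and the difference of the exit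
    times is at most the exit time [sigma] from a fixed large square. The cost of
    the coupling is therefore at most the integral over [A n] of a constant plus
    [sigma ^ (p / 2)], which tends to zero for the same reason as soon as [sigma]
    has finite moments ([integral_trivIset_cvg0], [p_brownian_cvg_disjoint]).

    The moments of [sigma] are finite because staying in a bounded set for a time
    [n] forces [n] independent Gaussian steps to be bounded, an event whose
    probability decays geometrically ([exit_time_box_tail],
    [geometric_tail_moment]). Finally, exit times and exit positions are measurable
    because an open set is the positivity set of a continuous function, so that a
    continuous path can be tested at rational times ([measurable_exit_time],
    [measurable_path_at]). *)

(** * Open sets given by a gauge *)

Lemma connected_setX (T1 T2 : topologicalType) (A : set T1) (B : set T2) :
  connected A -> connected B -> connected (A `*` B).
Proof.
move=> cA cB.
have [[[a0 b0] [/= Aa0 Bb0]]|/set0P/negP/negPn/eqP->] :=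
  pselect (A `*` B !=set0); last exact: connected0.
(* The product is a union of crosses that share the slice of ordinate [b0]. *)
have -> : A `*` B = \bigcup_(a in A)
    ((fun y => (a, y)) @` B `|` (fun x => (x, b0)) @` A).
  apply/seteqP; split=> [[x y] [/= Ax By]|z [a Aa [[y By <-]|[x Ax <-]]]] //.
  by exists x => //; left; exists y.
apply: bigcup_connected.
  by exists (a0, b0) => a Aa; right; exists a0.
move=> a Aa; apply: connectedU.
- by exists (a, b0); split; [exists b0|exists a].
- apply: connected_continuous_connected => //; apply: continuous_subspaceT.
  by move=> y; apply: cvg_pair => //=; exact: cvg_cst.
- apply: connected_continuous_connected => //; apply: continuous_subspaceT.
  by move=> y; apply: cvg_pair => //=; exact: cvg_cst.
Qed.

(** The open rectangle with abscissas in [(a, b)] and ordinates in [(c, d)]. *)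
Definition rect (R : realType) (a b c d : R) : set (R * R) :=
  [set z | [/\ a < z.1, z.1 < b, c < z.2 & z.2 < d]].

Lemma rectE (R : realType) (a b c d : R) : rect a b c d = `]a, b[ `*` `]c, d[.
Proof.
apply/seteqP; split=> z /=; rewrite !in_itv/=; first by case=> -> -> -> ->.
by case=> /andP[? ?] /andP[? ?]; split.
Qed.

Lemma rect_connected (R : realType) (a b c d : R) : connected (rect a b c d).
Proof.
by rewrite rectE; apply: connected_setX; apply/connected_intervalP;
  exact: interval_is_interval.
Qed.

(** The least of the signed distances to the four lines that bound the
    rectangle; it is positive exactly inside. *)
Definition rect_gauge (R : realType) (a b c d : R) (z : R * R) : R :=
  Num.min (Num.min (z.1 - a) (b - z.1)) (Num.min (z.2 - c) (d - z.2)).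

Lemma rect_gaugeE (R : realType) (a b c d : R) :
  rect a b c d = [set z | 0 < rect_gauge a b c d z].
Proof.
apply/seteqP; split=> z /=; rewrite /rect_gauge !lt_min !subr_gt0.
  by case=> -> -> -> ->.
by move=> /andP[/andP[? ?] /andP[? ?]]; split.
Qed.

Lemma continuous_rect_gauge (R : realType) (a b c d : R) :
  continuous (rect_gauge a b c d).
Proof.
have c1 : continuous (fst : R * R -> R) by move=> z; exact: cvg_fst.
have c2 : continuous (snd : R * R -> R) by move=> z; exact: cvg_snd.
move=> z; apply: (@continuous_min _ _ (fun z : R * R => Num.min (z.1 - a) (b - z.1))
  (fun z : R * R => Num.min (z.2 - c) (d - z.2))).
  apply: (@continuous_min _ _ (fun z : R * R => z.1 - a) (fun z : R * R => b - z.1));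
  apply: continuousB; by [exact: c1|exact: c2|exact: cst_continuous].
apply: (@continuous_min _ _ (fun z : R * R => z.2 - c) (fun z : R * R => d - z.2));
apply: continuousB; by [exact: c1|exact: c2|exact: cst_continuous].
Qed.

Lemma measurable_rect_gauge (R : realType) (a b c d : R) :
  measurable_fun setT (rect_gauge a b c d).
Proof.
by apply: measurable_minr; apply: measurable_minr; apply: measurable_funB => //.
Qed.

Lemma open_pos (T : topologicalType) (R : realType) (g : T -> R) :
  continuous g -> open [set z | 0 < g z].
Proof.
move=> cg; apply: (@open_comp _ _ g [set x | 0 < x]) => [z _|]; first exact: cg.
exact: open_gt.
Qed.

(** A gauged set is the positivity set of a continuous measurable function.
    Every open set is one, by the distance to its complement; recording the
    function makes the set open and measurable at once, and the statement that a
    path stays inside the set up to time [t] becomes a lower bound on the values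
    of the gauge at rational times. *)
Definition gauged (R : realType) (U : set (R * R)) : Prop :=
  exists g : R * R -> R,
    [/\ continuous g, measurable_fun setT g & U = [set z | 0 < g z]].

Lemma gauged_open (R : realType) (U : set (R * R)) : gauged U -> open U.
Proof. by move=> [g [cg _ ->]]; exact: open_pos. Qed.

Lemma measurable_gauged (R : realType) (U : set (R * R)) : gauged U -> measurable U.
Proof.
move=> [g [_ mg ->]]; rewrite (_ : [set z | _] = setT `&` g @^-1` `]0, +oo[%classic).
  by apply: mg => //; exact: measurable_itv.
by rewrite setTI; apply/seteqP; split=> z /=; rewrite in_itv/= andbT.
Qed.

Lemma gauged_rect (R : realType) (a b c d : R) : gauged (rect a b c d).
Proof.
by exists (rect_gauge a b c d); split;
  [exact: continuous_rect_gauge|exact: measurable_rect_gauge|exact: rect_gaugeE].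
Qed.

Lemma gaugedU (R : realType) (U V : set (R * R)) :
  gauged U -> gauged V -> gauged (U `|` V).
Proof.
move=> [g [cg mg ->]] [h [ch mh ->]]; exists (fun z => Num.max (g z) (h z)); split.
- by move=> z; apply: (@continuous_max _ _ g h); [exact: cg|exact: ch].
- exact: measurable_maxr.
- apply/seteqP; split=> z /=; rewrite lt_max.
    by case=> ->; rewrite ?orbT.
  by move=> /orP.
Qed.

(** The open square of side [2 r] centred at the origin. *)
Definition box (R : realType) (r : R) : set (R * R) := rect (- r) r (- r) r.

Lemma box_bound (R : realType) (r : R) (z : R * R) :
  box r z -> `|z.1| <= r /\ `|z.2| <= r.
Proof. by case=> *; rewrite !ler_norml; split; apply/andP; split; exact: ltW. Qed.

Lemma closed_square (R : realType) (r : R) :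
  closed [set z : R * R | `|z.1| <= r /\ `|z.2| <= r].
Proof.
rewrite -[X in closed X]/([set z : R * R | `|z.1| <= r] `&` [set z | `|z.2| <= r]).
apply: closedI.
  apply: (@closed_comp _ _ (fun z : R * R => `|z.1|) [set x | x <= r]) => [z _|].
    by apply: cvg_norm; exact: cvg_fst.
  exact: closed_le.
apply: (@closed_comp _ _ (fun z : R * R => `|z.2|) [set x | x <= r]) => [z _|].
  by apply: cvg_norm; exact: cvg_snd.
exact: closed_le.
Qed.

(** * Exit times along a continuous path *)

(** A path is only continuous within the nonnegative times, so the neighbourhood
    obtained is restricted to them. *)
Lemma path_near_open (R : realType) (T : topologicalType) (f : R -> T)
    (V : set T) (t : R) :
  {within `[0, +oo[, continuous f} -> open V -> 0 <= t -> V (f t) ->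
  exists2 e : R, 0 < e & forall s, 0 <= s -> `|s - t| < e -> V (f s).
Proof.
move=> /subspace_continuousP cf oV t0 Vt.
have At : `[0, +oo[%classic t by rewrite /= in_itv/= t0.
have /(_ V) := cf _ At; rewrite /fmap/= => H.
have : nbhs (f t) V by exact: open_nbhs_nbhs.
move=> /H [e /= e0 He]; exists e => // s s0 st.
by apply: He; rewrite /= ?in_itv/= ?s0//= distrC.
Qed.

Lemma path_cvg_seq (R : realType) (T : topologicalType) (f : R -> T)
    (u : nat -> R) (t : R) :
  {within `[0, +oo[, continuous f} -> (forall n, 0 <= u n) -> 0 <= t ->
  u n @[n --> \oo] --> t -> f (u n) @[n --> \oo] --> f t.
Proof.
move=> /subspace_continuousP cf u0 t0 ut.
have At : `[0, +oo[%classic t by rewrite /= in_itv/= t0.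
move=> V /(cf _ At) [e /= e0 He].
have [N _ HN] : \forall n \near \oo, ball t e (u n).
  by apply: ut; exact: nbhsx_ballx.
exists N => //= n /HN ?; apply: He => //.
by rewrite /= in_itv/= u0.
Qed.

Lemma exit_time_ge0 (R : realType) (T : Type) (Z : R -> T -> R * R)
  (U : set (R * R)) (w : T) : (0 <= exit_time Z U w)%E.
Proof. by apply: le_ereal_inf_tmp => _ [t [t0 _] <-]; rewrite lee_fin. Qed.

Lemma exit_time_le (R : realType) (T : Type) (Z : R -> T -> R * R)
    (U : set (R * R)) (w : T) (t : R) :
  0 <= t -> ~ U (Z t w) -> (exit_time Z U w <= t%:E)%E.
Proof. by move=> t0 Ut; apply: ereal_inf_lbound; exists t. Qed.

Lemma exit_time_gt_in (R : realType) (T : Type) (Z : R -> T -> R * R)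
    (U : set (R * R)) (w : T) (t : R) :
  0 <= t -> (t%:E < exit_time Z U w)%E -> U (Z t w).
Proof.
move=> t0 tU; apply: contrapT => Ut; move: tU.
by apply/negP; rewrite -leNgt; exact: exit_time_le.
Qed.

Lemma le_exit_time (R : realType) (T : Type) (Z : R -> T -> R * R)
    (U V : set (R * R)) (w : T) :
  U `<=` V -> (exit_time Z U w <= exit_time Z V w)%E.
Proof.
move=> UV; apply: ereal_inf_le_tmp => _ [t [t0 Vt] <-].
by exists t => //; split=> // /UV.
Qed.

Lemma exit_time_fin (R : realType) (T : Type) (Z : R -> T -> R * R)
    (U V : set (R * R)) (w : T) :
  U `<=` V -> exit_time Z V w <> +oo%E -> exit_time Z U w \is a fin_num.
Proof.
move=> UV oo; rewrite ge0_fin_numE ?exit_time_ge0//.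
by apply: le_lt_trans (le_exit_time Z w UV) _; rewrite ltey; apply/eqP.
Qed.

(** A finite exit time is attained: the times spent outside an open set form a
    closed set. *)
Lemma exit_time_notin (R : realType) (T : Type) (Z : R -> T -> R * R)
    (U : set (R * R)) (w : T) (t : R) :
  {within `[0, +oo[, continuous (Z^~ w)} -> open U ->
  exit_time Z U w = t%:E -> ~ U (Z t w).
Proof.
move=> cZ oU Et Ut.
have t0 : 0 <= t by rewrite -lee_fin -Et exit_time_ge0.
have [e e0 He] := path_near_open cZ oU t0 Ut.
have : ((t + e)%:E <= exit_time Z U w)%E.
  apply: le_ereal_inf_tmp => _ [s [s0 Us] <-]; rewrite lee_fin leNgt.
  apply/negP => ste; apply: Us.
  have [st|ts] := ltP s t.
    by apply: (@exit_time_gt_in _ _ Z) => //; rewrite Et lte_fin.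
  by apply: He => //; rewrite ger0_norm ?subr_ge0// ltrBlDl.
by rewrite Et lee_fin; lra.
Qed.

Lemma exit_time_gtP (R : realType) (T : Type) (Z : R -> T -> R * R)
    (U : set (R * R)) (w : T) (t : R) :
  {within `[0, +oo[, continuous (Z^~ w)} -> open U ->
  (t%:E < exit_time Z U w)%E <-> (forall s, 0 <= s <= t -> U (Z s w)).
Proof.
move=> cZ oU; split.
  move=> tU s /andP[s0 st]; apply: (@exit_time_gt_in _ _ Z) => //.
  by rewrite (le_lt_trans _ tU)// lee_fin.
move=> H; rewrite ltNge; apply/negP.
case E : (exit_time Z U w) => [s| |] //; last first.
  by have := exit_time_ge0 Z U w; rewrite E.
rewrite lee_fin => st; apply: (exit_time_notin cZ oU E); apply: H.
by rewrite st -lee_fin -E exit_time_ge0.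
Qed.

(** If the path is also outside the larger set when it leaves the smaller one,
    both exits happen at once. *)
Lemma eq_exit_time (R : realType) (T : Type) (Z : R -> T -> R * R)
    (U V : set (R * R)) (w : T) (t : R) :
  U `<=` V -> exit_time Z U w = t%:E -> ~ V (Z t w) -> exit_time Z V w = t%:E.
Proof.
move=> UV Et Vt; apply/eqP; rewrite eq_le exit_time_le//=.
  by rewrite -Et le_exit_time.
by rewrite -lee_fin -Et exit_time_ge0.
Qed.

(** The exit position is a limit of positions in [U]; this needs a start in [U],
    since otherwise the exit occurs at time [0]. *)
Lemma exit_point_closed (R : realType) (T : Type) (Z : R -> T -> R * R)
    (U F : set (R * R)) (w : T) (t : R) :
  {within `[0, +oo[, continuous (Z^~ w)} -> open U -> closed F -> U `<=` F ->
  U (Z 0 w) -> exit_time Z U w = t%:E -> F (Z t w).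
Proof.
move=> cZ oU cF UF U0 Et; apply: contrapT => Ft.
have : (0%:E < exit_time Z U w)%E.
  by apply/exit_time_gtP => // s; rewrite -eq_le => /eqP <-.
rewrite Et lte_fin => t0.
have [e e0 He] := path_near_open cZ (closed_openC cF) (ltW t0) Ft.
pose s := Num.max 0 (t - e / 2).
have s0 : 0 <= s by rewrite /s le_max lexx.
have st : s < t by rewrite /s gt_max t0 /=; lra.
apply: (He s s0).
  rewrite ltr0_norm ?subr_lt0// opprB ltrBlDr.
  by have : t - e / 2 <= s; [rewrite /s le_max lexx orbT|lra].
apply: UF; apply: (@exit_time_gt_in _ _ Z U) => //; by rewrite Et lte_fin.
Qed.

(** * Measurability of the exit pair *)

(** Compactness of [[0, t]] gives a positive lower bound for the gauge along the
    path, and density of the rationals recovers the bound at all times. *)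
Lemma path_gauge_gtP (R : realType) (f : R -> R * R) (g : R * R -> R) (t : R) :
  {within `[0, +oo[, continuous f} -> continuous g -> 0 <= t ->
  (forall s, 0 <= s <= t -> 0 < g (f s)) <->
  (exists m : nat, forall q : rat, 0 <= ratr q :> R -> ratr q <= t ->
     m.+1%:R^-1 <= g (f (ratr q))).
Proof.
move=> cf cg t0; split=> [pos|[m Hm] s /andP[s0 st]].
  have sub : (`[0, t]%classic : set R) `<=` `[0, +oo[%classic.
    by move=> x /=; rewrite !in_itv/= => /andP[-> _].
  have cgf : {within `[0, t], continuous (g \o f)}.
    apply: within_continuous_comp; first by move=> z _; exact: cg.
    exact: (continuous_subspaceW sub cf).
  have [c /[!in_itv]/= c0t Hc] := EVT_min t0 cgf.
  have gc : 0 < (g (f c))^-1 by rewrite invr_gt0 pos.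
  exists (Num.truncn (g (f c))^-1) => q q0 qt.
  apply: (@le_trans _ _ (g (f c))); last by apply: Hc; rewrite in_itv/= q0.
  by rewrite invf_ple ?posrE ?pos// ltW// truncnS_gt.
apply: (@lt_le_trans _ _ m.+1%:R^-1); first by rewrite invr_gt0 ltr0n.
rewrite leNgt; apply/negP => gs.
have oV : open [set z | g z < m.+1%:R^-1].
  apply: (@open_comp _ _ g [set x | x < m.+1%:R^-1]) => [z _|]; first exact: cg.
  exact: open_lt.
have [e e0 He] := path_near_open cf oV s0 gs.
have [s0'|s0'] := eqVneq s 0.
  have := Hm 0; rewrite rmorph0 => /(_ (lexx _) t0).
  by rewrite -s0' leNgt gs.
have spos : 0 < s by rewrite lt_neqAle eq_sym s0'.
have : Num.max 0 (s - e) < s by rewrite gt_max spos/= ltrBlDr ltrDl.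
move=> /rat_in_itvoo[q] /[!in_itv]/= /andP[]; rewrite gt_max => /andP[q0 qe] qs.
have := Hm q (ltW q0) (le_trans (ltW qs) st).
rewrite leNgt => /negP; apply; apply: He; first exact: ltW.
by rewrite ltr0_norm ?subr_lt0// opprB; lra.
Qed.

Lemma measurable_exit_time (R : realType) (d : measure_display)
    (T : measurableType d) (Z : R -> T -> R * R) (U : set (R * R)) :
  (forall t, 0 <= t -> measurable_fun setT (Z t)) ->
  (forall w, {within `[0, +oo[, continuous (Z^~ w)}) -> gauged U ->
  measurable_fun setT (exit_time Z U).
Proof.
move=> mZ cZ gU mT; have oU := gauged_open gU.
case: gU => g [cg mg UE].
apply: (measurability _ (ErealGenOInfty.measurableE R)) => //.
move=> _ [_ [r ->] <-]; rewrite setTI.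
have [r0|r0] := ltP r 0.
  rewrite [X in measurable X](_ : _ = setT)//.
  apply/seteqP; split=> // w _ /=; rewrite in_itv/= andbT.
  by apply: (lt_le_trans _ (exit_time_ge0 Z U w)); rewrite lte_fin.
have -> : exit_time Z U @^-1` `]r%:E, +oo[%classic =
    \bigcup_(m : nat) \bigcap_(q : rat)
      [set w | 0 <= ratr q :> R -> ratr q <= r ->
         m.+1%:R^-1 <= g (Z (ratr q) w)].
  apply/seteqP; split=> w /=; rewrite ?in_itv/= ?andbT.
    move=> /(exit_time_gtP _ (cZ w) oU); rewrite UE/=.
    by move=> /(path_gauge_gtP (cZ w) cg r0)[m Hm]; exists m => // q _; exact: Hm.
  move=> [m _ Hm].
  apply/(exit_time_gtP _ (cZ w) oU); rewrite UE/=.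
  by apply/(path_gauge_gtP (cZ w) cg r0); exists m => q; exact: Hm.
apply: bigcupT_measurable => m; rewrite -[X in measurable X]setCK setC_bigcap.
apply: measurableC; apply: bigcupT_measurable_rat => q; apply: measurableC.
have [q0|q0] := boolP (0 <= ratr q :> R); last first.
  by rewrite [X in measurable X](_ : _ = setT)//; apply/seteqP; split.
have [qr|qr] := boolP (ratr q <= r); last first.
  by rewrite [X in measurable X](_ : _ = setT)//; apply/seteqP; split.
rewrite [X in measurable X](_ : _ =
    (g \o Z (ratr q)) @^-1` `[m.+1%:R^-1, +oo[%classic); last first.
  by apply/seteqP; split=> w /=; rewrite in_itv/= andbT//; exact.
rewrite -[X in measurable X]setTI.
by apply: measurableT_comp => //; exact: mZ.
Qed.

(** Selecting one of countably many measurable maps by a measurable index. *)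
Lemma measurable_fun_natindex (d d' : measure_display) (T : measurableType d)
    (T' : measurableType d') (k : T -> nat) (h : nat -> T -> T') :
  measurable_fun setT k -> (forall n, measurable_fun setT (h n)) ->
  measurable_fun setT (fun w => h (k w) w).
Proof.
move=> mk mh _ A mA; rewrite setTI.
rewrite [X in measurable X](_ : _ =
    \bigcup_n (k @^-1` [set n] `&` h n @^-1` A)); last first.
  by apply/seteqP; split=> [w /= Aw|w [n _ [/= <-]]]//; exists (k w).
apply: bigcupT_measurable => n; apply: measurableI.
  by rewrite -[X in measurable X]setTI; exact: mk.
by rewrite -[X in measurable X]setTI; exact: mh.
Qed.

(** The position at a random time is measurable: approximate the time from above
    by times of the form [(k + 1) / (n + 1)] and use the continuity of paths. *)
Lemma measurable_path_at (R : realType) (d : measure_display)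
    (T : measurableType d) (Z : R -> T -> R * R) (s : T -> R) :
  (forall t, 0 <= t -> measurable_fun setT (Z t)) ->
  (forall w, {within `[0, +oo[, continuous (Z^~ w)}) ->
  measurable_fun setT s -> (forall w, 0 <= s w) ->
  measurable_fun setT (fun w => Z (s w) w).
Proof.
move=> mZ cZ ms s0.
pose k n w := Num.truncn (s w * n.+1%:R).
pose u n w : R := (k n w).+1%:R / n.+1%:R.
have u0 n w : 0 <= u n w by rewrite divr_ge0.
have us w : u n w @[n --> \oo] --> s w.
  apply: (@squeeze_cvgr _ _ _ _ (fun=> s w) (fun n => s w + n.+1%:R^-1)).
  - apply: nearW => n; rewrite /u /k.
    have /andP[h1 h2] := truncn_itv (mulr_ge0 (s0 w) (ler0n R n.+1)).
    rewrite ler_pdivlMr ?ltr0n// (ltW h2)/= ler_pdivrMr ?ltr0n// mulrDl.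
    by rewrite mulVf ?pnatr_eq0// -natr1 lerD2r.
  - exact: cvg_cst.
  - rewrite -[X in _ --> X]addr0; apply: cvgD; first exact: cvg_cst.
    exact: cvg_harmonic.
have mk n : measurable_fun setT (k n).
  move=> _ A _; rewrite setTI.
  rewrite [X in measurable X](_ : _ = \bigcup_(j in A)
      (fun w => s w * n.+1%:R) @^-1` `[j%:R, j.+1%:R[%classic); last first.
    apply/seteqP; split=> w /=.
      by move=> Aw; exists (k n w) => //=; rewrite in_itv/= truncn_itv// mulr_ge0.
    by move=> [j Aj /=]; rewrite in_itv/= /k => /truncn_def ->.
  apply: bigcup_measurable => j _; rewrite -[X in measurable X]setTI.
  by apply: measurable_funM => //; exact: measurable_itv.
have mh n : measurable_fun setT (fun w => Z (u n w) w).
  apply: (@measurable_fun_natindex _ _ _ _ (k n) (fun j => Z (j.+1%:R / n.+1%:R))) => //.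
  by move=> j; exact: mZ.
have cu w : Z (u n w) w @[n --> \oo] --> Z (s w) w.
  exact: (@path_cvg_seq _ _ (Z^~ w)).
apply/measurable_fun_pairP; split.
- apply: (@measurable_fun_cvg _ _ _ _ (fun n w => (Z (u n w) w).1)).
    by move=> n; exact: measurableT_comp.
  by move=> w _; apply: (cvg_comp _ _ (cu w)); exact: cvg_fst.
- apply: (@measurable_fun_cvg _ _ _ _ (fun n w => (Z (u n w) w).2)).
    by move=> n; exact: measurableT_comp.
  by move=> w _; apply: (cvg_comp _ _ (cu w)); exact: cvg_snd.
Qed.

Lemma measurable_exit_point (R : realType) (d : measure_display)
    (T : measurableType d) (P : probability T R) (Z : R -> T -> R * R)
    (U : set (R * R)) :
  planar_brownian P Z -> gauged U ->
  measurable_fun setT (fun w => Z (fine (exit_time Z U w)) w).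
Proof.
case=> mZ _ cZ _ _ gU; apply: measurable_path_at => //.
  by apply: measurableT_comp => //; exact: measurable_exit_time.
by move=> w; rewrite fine_ge0// exit_time_ge0.
Qed.

Lemma measurable_fine_exit_time (R : realType) (d : measure_display)
    (T : measurableType d) (P : probability T R) (Z : R -> T -> R * R)
    (U : set (R * R)) :
  planar_brownian P Z -> gauged U ->
  measurable_fun setT (fun w => fine (exit_time Z U w)).
Proof.
by case=> mZ _ cZ _ _ gU; apply: measurableT_comp => //; exact: measurable_exit_time.
Qed.

(** * Moments of the exit time from a square *)

Lemma normal_prob_segment_gt0 (R : realType) (a b : R) :
  a < b -> (0 < normal_prob 0 1 `[a, b])%E.
Proof.
move=> ab.
have cpdf : {within `[a, b], continuous (normal_pdf (0 : R) 1)}.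
  by apply: continuous_subspaceT => x; exact: continuous_normal_pdf (oner_neq0 R) x.
have [c _ Hc] := EVT_min (ltW ab) cpdf.
have c0 : 0 < normal_pdf 0 1 c.
  by rewrite normal_pdfE ?oner_neq0// mulr_gt0 ?expR_gt0// normal_peak_gt0 ?oner_neq0.
apply: (@lt_le_trans _ _ (\int[lebesgue_measure]_(x in `[a, b]) (normal_pdf 0 1 c)%:E)%E).
  rewrite integral_cst//= lebesgue_measure_itv/= lte_fin ab -EFinD -EFinM lte_fin.
  by rewrite mulr_gt0// subr_gt0.
apply: ge0_le_integral => //=.
- by move=> x _; rewrite lee_fin normal_pdf_ge0.
- by apply/measurable_EFinP; apply: measurable_funTS; exact: measurable_normal_pdf.
Qed.

Lemma normal_prob_itv_lt1 (R : realType) (a : R) :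
  (normal_prob 0 1 `](- a)%R, a[ < 1)%E.
Proof.
have mA : measurable (`[a, a + 1]%classic : set R) by exact: measurable_itv.
apply: (@le_lt_trans _ _ (normal_prob 0 1 (~` `[a, a + 1]))).
  apply: le_measure; rewrite ?inE//; first exact: measurableC.
  by move=> x /=; rewrite !in_itv/= => /andP[_ xa]; rewrite leNgt xa.
rewrite probability_setC// lte_subel_addl// addeC.
by rewrite lteDl// normal_prob_segment_gt0// ltrDl.
Qed.

(** A motion that has not left the square of half-side [r] before time [n] has
    made [n] independent unit-time steps whose first coordinates are smaller than
    [2 r] in absolute value, so the probability of this event decays
    geometrically. *)
Lemma exit_time_box_tail (R : realType) (d : measure_display)
    (T : measurableType d) (P : probability T R) (Z : R -> T -> R * R) (r : R) :
  planar_brownian P Z ->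
  exists c : R, [/\ 0 < c, c < 1 & forall n : nat,
    (P [set w | n%:R%:E < exit_time Z (box r) w] <= (c ^+ n)%:E)%E].
Proof.
case=> mZ Z0 cZ nZ iZ.
pose N1 := normal_prob (0 : R) 1 `](- (r *+ 2))%R, (r *+ 2)%R[.
pose S : set (R * R) := `]- (r *+ 2), r *+ 2[ `*` setT.
have mS : measurable S by apply: measurableX => //; exact: measurable_itv.
have N1_ge0 : (0 <= N1)%E by exact: measure_ge0.
have N1_lt1 : (N1 < 1)%E by exact: normal_prob_itv_lt1.
have fN : N1 \is a fin_num by rewrite ge0_fin_numE// (lt_trans N1_lt1)// ltry.
have f0 : 0 <= fine N1 by rewrite fine_ge0.
have f1 : fine N1 < 1 by rewrite -lte_fin fineK.
(* Any number of (0, 1) that is at least the Gaussian mass [N1] would do. *)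
exists ((1 + fine N1) / 2); split; [lra|lra|].
move=> n.
have Pinc i : P ((fun w => Z i.+1%:R w - Z i%:R w) @^-1` S) = N1.
  rewrite nZ//; last by rewrite ltr_nat.
  rewrite -natrB// subSnn sqrtr1 product_measure1E//.
  have NT : normal_prob (0 : R) 1 setT = 1%E by exact: probability_setT.
  by transitivity (N1 * normal_prob (0 : R) 1 setT)%E => //; rewrite NT mule1.
apply: (@le_trans _ _ (P (\bigcap_(i in `I_n)
    ((fun w => Z i.+1%:R w - Z i%:R w) @^-1` S)))); last first.
  rewrite (iZ n (fun i => i%:R) _ _ (fun=> S))//; last first.
    by move=> i; rewrite ler_nat.
  rewrite (eq_bigr (fun=> N1)) => [|i _]; last exact: Pinc.
  rewrite -(fineK fN) prodEFin prodr_const card_ord.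
  by rewrite lee_fin/=; apply: lerXn2r; rewrite ?nnegrE; lra.
have mB : measurable [set w | (n%:R%:E < exit_time Z (box r) w)%E].
  rewrite -[X in measurable X]setTI; apply: emeasurable_fun_o_infty => //.
  apply: measurable_exit_time => //.
  exact: gauged_rect.
apply: le_measure; rewrite ?inE//.
  apply: bigcap_measurableType => i _.
  rewrite [X in measurable X](_ : _ = setT `&`
      (fun w => (Z i.+1%:R w).1 - (Z i%:R w).1) @^-1`
        `]- (r *+ 2), r *+ 2[%classic); last first.
    by rewrite setTI; apply/seteqP; split=> [w []|w]//=; split.
  apply: measurable_funB => //;
    by apply: measurableT_comp => //; exact: mZ.
move=> w /= nw i /= ni.
have inB (j : nat) : (j <= n)%N -> box r (Z j%:R w).
  move=> jn; apply: (@exit_time_gt_in _ _ Z) => //.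
  by apply: le_lt_trans nw; rewrite lee_fin ler_nat.
have [a1 a2 _ _] := inB _ ni; have [b1 b2 _ _] := inB _ (ltnW ni).
by split=> //=; rewrite in_itv/= mulr2n; apply/andP; split; lra.
Qed.

Lemma nneseries_geometric_lty (R : realType) (a z : R) :
  0 <= a -> 0 < z -> z < 1 -> (\sum_(k <oo) (a * z ^+ k)%:E < +oo)%E.
Proof.
move=> a0 z0 z1; apply: (@le_lt_trans _ _ (a * (1 - z)^-1)%:E); last exact: ltry.
apply: lime_le.
  by apply: is_cvg_nneseries => k _ _; rewrite lee_fin mulr_ge0// exprn_ge0// ltW.
apply: nearW => n; rewrite sumEFin lee_fin.
by apply: (@geometric_le_lim R n) => //; rewrite gtr0_norm.
Qed.

(** Powers are dominated by exponentials; the inequality [1 + y <= expR y] at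
    [y = ln b * k / q] gives the explicit constant [(q / ln b) ^ q]. *)
Lemma powR_le_expn (R : realType) (q b : R) : 0 < q -> 1 < b ->
  exists2 K : R, 0 <= K & forall (x : R) (k : nat),
    0 <= x -> x <= k%:R -> x `^ q <= K * b ^+ k.
Proof.
move=> q0 b1; have b0 : 0 < b by apply: lt_trans b1.
have l0 : 0 < ln b by rewrite ln_gt0.
exists ((q / ln b) `^ q) => [|x k x0 xk]; first exact: powR_ge0.
have -> : b ^+ k = (expR (ln b * k%:R / q)) `^ q.
  by rewrite -expRM -mulrA mulVf ?gt_eqF// mulr1 expRM_natr lnK.
rewrite -powRM ?expR_ge0//; last by rewrite divr_ge0// ltW.
apply: ge0_ler_powR; rewrite ?nnegrE//; first exact: ltW.
  by rewrite mulr_ge0 ?expR_ge0// divr_ge0// ltW.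
rewrite -ler_pdivrMl ?divr_gt0// invf_div.
apply: (@le_trans _ _ (ln b * k%:R / q)).
  by rewrite mulrAC ler_pM2r ?invr_gt0// ler_pM2l.
by apply: le_trans (expR_ge1Dx _); rewrite lerDr.
Qed.

Lemma geometric_tail_fin (R : realType) (d : measure_display)
    (T : measurableType d) (P : probability T R) (X : T -> \bar R) (c : R) :
  measurable_fun setT X -> 0 < c -> c < 1 ->
  (forall n : nat, (P [set w | n%:R%:E < X w] <= (c ^+ n)%:E)%E) ->
  P [set w | X w = +oo%E] = 0%E.
Proof.
move=> mX c0 c1 tail.
have mI : measurable [set w | X w = +oo%E].
  rewrite -[X in measurable X]setTI.
  by apply: (mX _ [set +oo%E]) => //; exact: emeasurable_set1.
have fP : P [set w | X w = +oo%E] \is a fin_num by exact: fin_num_measure.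
apply/eqP; rewrite eq_le measure_ge0 andbT -[X in (X <= _)%E](fineK fP) lee_fin.
apply: (ler_cvg_to (cvg_cst _) (@cvg_expr R c _)); first by rewrite gtr0_norm.
apply: nearW => n; rewrite -lee_fin fineK//; apply: le_trans (tail n).
apply: le_measure; rewrite ?inE//; last by move=> w /= ->; exact: ltry.
by rewrite -[X in measurable X]setTI; exact: emeasurable_fun_o_infty.
Qed.

(** The value [+oo] is sent to [0] by [fine]; it is taken with probability zero
    by the previous lemma. *)
Lemma geometric_tail_moment (R : realType) (d : measure_display)
    (T : measurableType d) (P : probability T R) (X : T -> \bar R) (c q : R) :
  measurable_fun setT X -> 0 < q -> 0 < c -> c < 1 ->
  (forall n : nat, (P [set w | n%:R%:E < X w] <= (c ^+ n)%:E)%E) ->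
  (forall w, (0 <= X w)%E) ->
  (\int[P]_w ((fine (X w)) `^ q)%:E < +oo)%E.
Proof.
move=> mX q0 c0 c1 tail X0.
(* A base with 1 < b and b * c < 1, so that [b ^ k] times the tail is summable. *)
pose b := 2 / (1 + c).
have b1 : 1 < b by rewrite /b ltr_pdivlMr; lra.
have b0 : 0 < b by apply: lt_trans b1.
have bc : b * c < 1 by rewrite /b mulrAC ltr_pdivrMr; lra.
move: b b1 b0 bc => b b1 b0 bc.
have [K K0 HK] := powR_le_expn q0 b1.
have mE n : measurable [set w | (n%:R%:E < X w)%E].
  by rewrite -[X in measurable X]setTI; exact: emeasurable_fun_o_infty.
pose f (n : nat) w : \bar R :=
  ((K * b ^+ n.+1)%:E * (\1_[set w | (n%:R%:E < X w)%E] w)%:E)%E.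
have Kb n : 0 <= K * b ^+ n by rewrite mulr_ge0// exprn_ge0// ltW.
have f0 n w : (0 <= f n w)%E by rewrite mule_ge0// lee_fin.
have mf n : measurable_fun setT (f n).
  apply: emeasurable_funM; first exact: measurable_cst.
  by apply/measurable_EFinP; exact: measurable_indic.
apply: (@le_lt_trans _ _ (\int[P]_w (\sum_(n <oo) f n w))%E).
  apply: ge0_le_integral => //.
  - by move=> w _; rewrite lee_fin powR_ge0.
  - apply/measurable_EFinP; apply: (measurableT_comp (measurable_powR _)).
    exact: measurableT_comp.
  - by apply: ge0_emeasurable_sum => //.
  - move=> w _; case EX : (X w) => [x| |] /=; last 2 first.
    + by rewrite powR0 ?gt_eqF//; apply: nneseries_ge0.
    + by rewrite powR0 ?gt_eqF//; apply: nneseries_ge0.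
    have x0 : 0 <= x by rewrite -lee_fin -EX.
    have [->|xn0] := eqVneq x 0.
      by rewrite powR0 ?gt_eqF//; apply: nneseries_ge0.
    have xpos : 0 < x by rewrite lt_neqAle eq_sym xn0.
    have [k kx xk] : exists2 k : nat, k%:R < x & x <= k.+1%:R.
      have /ex_minnP[[|k]] : exists n, x <= n%:R.
        by exists (Num.truncn x).+1; exact/ltW/truncnS_gt.
        by rewrite leNgt xpos.
      move=> xk minx; exists k => //; rewrite ltNge; apply/negP => /minx.
      by rewrite ltnn.
    (* The term of index [k], with k < x <= k + 1, already dominates [x `^ q]. *)
    apply: (@le_trans _ _ (\sum_(0 <= i < k.+1) f i w)%E); last first.
      by apply: nneseries_lim_ge.
    rewrite big_nat_recr//=; apply: (@le_trans _ _ (f k w)); last first.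
      by rewrite leeDr// sume_ge0.
    by rewrite /f indicE mem_set /= ?EX ?lte_fin// mule1 lee_fin HK.
rewrite integral_nneseries//.
apply: le_lt_trans (@nneseries_geometric_lty R (K * b) (b * c) _ _ bc).
- apply: lee_nneseries => [n _ _|n _]; first exact: integral_ge0.
  rewrite ge0_integralZl ?lee_fin//; last first.
    by apply/measurable_EFinP; exact: measurable_indic.
  rewrite integral_indic// setIT.
  apply: (@le_trans _ _ ((K * b ^+ n.+1)%:E * (c ^+ n)%:E)%E).
    by apply: lee_wpmul2l; [rewrite lee_fin|exact: tail].
  by rewrite -EFinM lee_fin exprS exprMn -!mulrA.
- by rewrite mulr_ge0// ltW.
- by rewrite mulr_gt0.
Qed.

Lemma exit_time_box_lty (R : realType) (d : measure_display)
    (T : measurableType d) (P : probability T R) (Z : R -> T -> R * R) (r : R) :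
  planar_brownian P Z -> P [set w | exit_time Z (box r) w = +oo%E] = 0%E.
Proof.
move=> HZ; have [mZ _ cZ _ _] := HZ.
have [c [c0 c1 tail]] := exit_time_box_tail r HZ.
by apply: (geometric_tail_fin _ c0 c1 tail); apply: measurable_exit_time => //;
  exact: gauged_rect.
Qed.

Lemma exit_time_box_moment (R : realType) (d : measure_display)
    (T : measurableType d) (P : probability T R) (Z : R -> T -> R * R) (r q : R) :
  planar_brownian P Z -> 0 < q ->
  (\int[P]_w ((fine (exit_time Z (box r) w)) `^ q)%:E < +oo)%E.
Proof.
move=> HZ q0; have [mZ _ cZ _ _] := HZ.
have [c [c0 c1 tail]] := exit_time_box_tail r HZ.
apply: (geometric_tail_moment _ q0 c0 c1 tail).
  by apply: measurable_exit_time => //; exact: gauged_rect.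
by move=> w; exact: exit_time_ge0.
Qed.

(** * Integrals over disjoint events and null sets *)

(** The integrals over disjoint sets form a convergent series, so they tend to
    zero; no estimate on the individual sets is needed. *)
Lemma integral_trivIset_cvg0 (R : realType) (d : measure_display)
    (T : measurableType d) (mu : {measure set T -> \bar R})
    (A : nat -> set T) (h : T -> \bar R) :
  (forall n, measurable (A n)) -> trivIset setT A -> measurable_fun setT h ->
  (forall w, (0 <= h w)%E) -> (\int[mu]_w h w < +oo)%E ->
  (\int[mu]_(w in A n) h w)%E @[n --> \oo] --> 0%E.
Proof.
move=> mA tA mh h0 hoo.
have a0 n : (0 <= \int[mu]_(w in A n) h w)%E by exact: integral_ge0.
have sumA : (\sum_(n <oo) \int[mu]_(w in A n) h w < +oo)%E.
  rewrite -ge0_integral_bigcup//; last exact: measurable_funTS.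
  apply: le_lt_trans hoo; apply: ge0_subset_integral => //.
  exact: bigcup_measurable.
apply: (@squeeze_cvge _ _ _ _ (cst 0%E) _ (fun N =>
   (\sum_(N <= n <oo) \int[mu]_(w in A n) h w)%E)).
- apply: nearW => n; rewrite a0/=.
  by have := @nneseries_lim_ge R _ xpredT n n.+1 (fun i _ _ => a0 i); rewrite big_nat1.
- exact: cvg_cst.
- exact: nneseries_tail_cvg.
Qed.

Lemma integral_le_off_null (R : realType) (d : measure_display)
    (T : measurableType d) (mu : {measure set T -> \bar R})
    (N A : set T) (f h : T -> \bar R) :
  measurable N -> mu N = 0%E -> measurable A ->
  measurable_fun setT f -> measurable_fun setT h ->
  (forall w, (0 <= f w)%E) -> (forall w, (0 <= h w)%E) ->
  (forall w, ~ N w -> ~ A w -> f w = 0%E) ->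
  (forall w, ~ N w -> A w -> (f w <= h w)%E) ->
  (\int[mu]_w f w <= \int[mu]_(w in A) h w)%E.
Proof.
move=> mN N0 mA mf mh f0 h0 fA fh; rewrite [leRHS]integral_mkcond.
apply: ae_ge0_le_integral => //.
- by move=> w _; rewrite patchE; case: ifP.
- by apply/(measurable_restrictT _ mA); exact: measurable_funTS.
exists N; split=> // w /= H; apply: contrapT => Nw; apply: H => _.
rewrite patchE; case: ifPn => [/set_mem Aw|/negP Aw]; first exact: fh.
by rewrite fA// => /mem_set.
Qed.

Lemma measure_preimage_off_null (R : realType) (d d' : measure_display)
    (T : measurableType d) (T' : measurableType d')
    (mu : {measure set T -> \bar R}) (N : set T) (X Y : T -> T') (A : set T') :
  measurable N -> mu N = 0%E -> measurable_fun setT X -> measurable_fun setT Y ->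
  (forall w, ~ N w -> X w = Y w) -> measurable A ->
  mu (X @^-1` A) = mu (Y @^-1` A).
Proof.
move=> mN N0 mX mY XY mA.
have mXA : measurable (X @^-1` A) by rewrite -[X in measurable X]setTI; exact: mX.
have mYA : measurable (Y @^-1` A) by rewrite -[X in measurable X]setTI; exact: mY.
rewrite -(measureU0 mXA mN N0) -(measureU0 mYA mN N0); congr (mu _).
apply/seteqP; split=> w /= [Aw|Nw]; (try by right);
  have [Nw|Nw] := pselect (N w); (try by right); left.
  by rewrite -XY.
by rewrite XY.
Qed.

(** * Convergence when the excesses are disjoint *)

Lemma measurable_cmod (R : realType) : measurable_fun setT (@cmod R).
Proof.
apply: (measurableT_comp (continuous_measurable_fun (@sqrt_continuous R))).
by apply: measurable_funD; apply: measurable_funX.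
Qed.

Lemma cmod0 (R : realType) : @cmod R 0 = 0.
Proof. by rewrite /cmod/= expr0n/= addr0 sqrtr0. Qed.

Lemma cmod_le (R : realType) (z : R * R) (r : R) :
  `|z.1| <= r -> `|z.2| <= r -> cmod z <= 2 * r.
Proof.
move=> z1 z2; have r0 : 0 <= r by apply: le_trans z1.
have -> : 2 * r = Num.sqrt ((2 * r) ^+ 2) by rewrite sqrtr_sqr ger0_norm// mulr_ge0.
rewrite /cmod ler_sqrt ?sqr_ge0// -(real_normK (num_real z.1)).
rewrite -(real_normK (num_real z.2)).
have := lerXn2r 2 (normr_ge0 z.1) r0 z1; have := lerXn2r 2 (normr_ge0 z.2) r0 z2.
by rewrite exprMn; nra.
Qed.

(** Replacing the exit time by its real part does not change the law of the exit
    pair, because the exit time from a bounded set is finite almost surely. *)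
Lemma exit_pair_law (R : realType) (d : measure_display)
    (T : measurableType d) (P : probability T R) (Z : R -> T -> R * R) (r : R)
    (U : set (R * R)) :
  planar_brownian P Z -> gauged U -> U `<=` box r ->
  forall A : set ((R * R) * \bar R), measurable A ->
  P ((fun w => (Z (fine (exit_time Z U w)) w, (fine (exit_time Z U w))%:E)) @^-1` A)
  = P (exit_pair Z U @^-1` A).
Proof.
move=> HZ gU Ur A mA; have [mZ _ cZ _ _] := HZ.
have mE := measurable_exit_time mZ cZ (gauged_rect (- r) r (- r) r).
apply: (@measure_preimage_off_null _ _ _ _ _ _
  [set w | exit_time Z (box r) w = +oo%E]) => //.
- rewrite -[X in measurable X]setTI; apply: (mE _ [set +oo%E]) => //.
- exact: exit_time_box_lty.
- apply: measurable_fun_pair; first exact: (measurable_exit_point HZ).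
  by apply/measurable_EFinP; exact: (measurable_fine_exit_time HZ).
- apply: measurable_fun_pair; first exact: (measurable_exit_point HZ).
  exact: measurable_exit_time.
- by move=> w /= Hw; rewrite /exit_pair fineK// (exit_time_fin Ur).
Qed.

(** The coupling of two exit pairs given by one and the same Brownian path. *)
Definition synchronous_coupling (R : realType) (d : measure_display)
    (T : measurableType d) (P : probability T R) (Z : R -> T -> R * R) (r : R)
    (V U : set (R * R)) (HZ : planar_brownian P Z)
    (gV : gauged V) (Vr : V `<=` box r) (gU : gauged U) (Ur : U `<=` box r) :
    exit_coupling P Z V U :=
  ExitCoupling (measurable_exit_point HZ gV) (measurable_fine_exit_time HZ gV)
    (measurable_exit_point HZ gU) (measurable_fine_exit_time HZ gU)
    (exit_pair_law HZ gV Vr) (exit_pair_law HZ gU Ur).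

(** If the sets [U_ n] are uniformly bounded supersets of [U] whose excesses
    [U_ n `\` U] are pairwise disjoint, then [U_ n] converges to [U] in the
    [p]-Brownian sense. The two exit pairs of one path differ only when the exit
    position from [U] lies in the excess, and these events are disjoint. *)
Lemma p_brownian_cvg_disjoint (R : realType) (p r : R) (U : set (R * R))
    (U_ : nat -> set (R * R)) :
  0 < p -> gauged U -> (forall n, gauged (U_ n)) -> U (0, 0) ->
  (forall n, U `<=` U_ n) -> (forall n, U_ n `<=` box r) ->
  (forall n m, n != m -> U_ n `&` U_ m `<=` U) -> p_brownian_cvg p U_ U.
Proof.
move=> p0 gU gV U0 UV Vr Vdis d T P Z HZ; have [mZ Z0 cZ _ _] := HZ.
have Ur : U `<=` box r := subset_trans (UV 0%N) (Vr 0%N).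
exists (fun n => synchronous_coupling HZ (gV n) (@Vr n) gU Ur).
pose sig := exit_time Z (box r).
pose N := [set w | sig w = +oo%E].
(* Removing [U] from [U_ n] discards the paths that never leave [U]: for them
   [fine] gives the time [0], where the path is at the origin. *)
pose A n := [set w | (U_ n `\` U) (Z (fine (exit_time Z U w)) w)].
have mA n : measurable (A n).
  rewrite -[X in measurable X]setTI; apply: (measurable_exit_point HZ gU) => //.
  by apply: measurableD; exact: measurable_gauged.
have tA : trivIset setT A.
  apply/trivIsetP => n m _ _ nm; apply/seteqP; split=> // w [[Un Uw] [Um _]].
  by apply: Uw; apply: (Vdis _ _ nm).
have msig : measurable_fun setT sig.
  by apply: measurable_exit_time => //; exact: gauged_rect.
have mN : measurable N.
  rewrite -[X in measurable X]setTI; apply: (msig _ [set +oo%E]) => //.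
have N0 : P N = 0%E by exact: exit_time_box_lty.
have r0 : 0 <= r.
  by have [/= h1 h2 _ _] := Ur _ U0; rewrite ltW.
(* Off the null event [N], the two exit times agree outside [A n]. *)
have same n w : ~ N w -> ~ A n w -> exit_time Z (U_ n) w = exit_time Z U w.
  move=> Nw Aw; have fin := exit_time_fin Ur Nw.
  have E : exit_time Z U w = (fine (exit_time Z U w))%:E by rewrite fineK.
  rewrite E; apply: (eq_exit_time (UV n) E) => UnZ; apply: Aw; split=> //.
  exact: (exit_time_notin (cZ w) (gauged_open gU) E).
have inside (V : set (R * R)) w : gauged V -> V `<=` box r -> V (0, 0) -> ~ N w ->
    `|(Z (fine (exit_time Z V w)) w).1| <= r /\
    `|(Z (fine (exit_time Z V w)) w).2| <= r.
  move=> gV' Vr' V0 Nw.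
  apply: (exit_point_closed (cZ w) (gauged_open gV') (@closed_square R r)).
  - by move=> z /Vr' /box_bound.
  - by rewrite Z0.
  - by rewrite fineK// (exit_time_fin Vr').
pose xi V w := Z (fine (exit_time Z V w)) w.
pose f1 n w := cmod (xi (U_ n) w - xi U w) `^ p.
pose f2 n w :=
  `|fine (exit_time Z (U_ n) w) - fine (exit_time Z U w)| `^ (p / 2).
have mf1 n : measurable_fun setT (EFin \o f1 n).
  apply/measurable_EFinP; apply: (measurableT_comp (measurable_powR _)).
  apply: (measurableT_comp (@measurable_cmod R)).
  have m1 := measurable_exit_point HZ (gV n).
  have m2 := measurable_exit_point HZ gU.
  apply: (measurable_fun_pair
    (f := fun w => (xi (U_ n) w).1 - (xi U w).1)
    (g := fun w => (xi (U_ n) w).2 - (xi U w).2));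
    by apply: measurable_funB; exact: measurableT_comp.
have mf2 n : measurable_fun setT (EFin \o f2 n).
  apply/measurable_EFinP; apply: (measurableT_comp (measurable_powR _)).
  apply: measurableT_comp => //.
  by apply: measurable_funB; exact: (measurable_fine_exit_time HZ).
have p20 : 0 < p / 2 by rewrite divr_gt0.
(* Two points of the closed square of half-side [r] differ by at most [r + r] in
   each coordinate. *)
pose h1 (w : T) : \bar R := ((2 * (r + r)) `^ p)%:E.
pose h2 (w : T) : \bar R := ((fine (sig w)) `^ (p / 2))%:E.
have mh1 : measurable_fun setT h1 by exact: measurable_cst.
have mh2 : measurable_fun setT h2.
  apply/measurable_EFinP; apply: (measurableT_comp (measurable_powR _)).
  exact: measurableT_comp.
have le1 n : (\int[P]_w (f1 n w)%:E <= \int[P]_(w in A n) h1 w)%E.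
  apply: (@integral_le_off_null _ _ _ _ N) => //; rewrite /f1 /xi.
  - exact: mf1.
  - by move=> w; rewrite lee_fin powR_ge0.
  - by move=> w; rewrite lee_fin powR_ge0.
  - by move=> w Nw Aw; rewrite same// subrr cmod0 powR0// gt_eqF.
  - move=> w Nw Aw; rewrite lee_fin.
    apply: ge0_ler_powR; rewrite ?nnegrE ?sqrtr_ge0 ?(ltW p0)//.
      by rewrite mulr_ge0// addr_ge0.
    have [a1 a2] := inside _ w (gV n) (@Vr n) (UV n _ U0) Nw.
    have [b1 b2] := inside _ w gU Ur U0 Nw.
    by apply: cmod_le => /=; apply: (le_trans (ler_normB _ _)); exact: lerD.
have le2 n : (\int[P]_w (f2 n w)%:E <= \int[P]_(w in A n) h2 w)%E.
  apply: (@integral_le_off_null _ _ _ _ N) => //; rewrite /f2.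
  - exact: mf2.
  - by move=> w; rewrite lee_fin powR_ge0.
  - by move=> w; rewrite lee_fin powR_ge0.
  - by move=> w Nw Aw; rewrite same// subrr normr0 powR0// gt_eqF.
  - move=> w Nw Aw; have f1w := exit_time_fin (@Vr n) Nw; have f2w := exit_time_fin Ur Nw.
    have l1 := le_exit_time Z w (UV n); have l2 := le_exit_time Z w (@Vr n).
    have fs : sig w \is a fin_num by exact: (exit_time_fin (@subset_refl _ _) Nw).
    rewrite lee_fin; apply: ge0_ler_powR; rewrite ?nnegrE ?(ltW p20)//.
      by rewrite fine_ge0// exit_time_ge0.
    rewrite ger0_norm ?subr_ge0 ?fine_le//.
    apply: (@le_trans _ _ (fine (exit_time Z (U_ n) w))).
      by rewrite lerBlDr lerDl fine_ge0// exit_time_ge0.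
    by rewrite fine_le.
have c1 : (\int[P]_(w in A n) h1 w)%E @[n --> \oo] --> 0%E.
  apply: integral_trivIset_cvg0 => //.
    by move=> w; rewrite lee_fin powR_ge0.
  have PT : (P : set T -> \bar R) setT = 1%E by exact: probability_setT.
  by rewrite integral_cst//= PT mule1 ltry.
have c2 : (\int[P]_(w in A n) h2 w)%E @[n --> \oo] --> 0%E.
  apply: integral_trivIset_cvg0 => //.
    by move=> w; rewrite lee_fin powR_ge0.
  exact: exit_time_box_moment.
apply: (@squeeze_cvge _ _ _ _ (cst 0%E) _
  (fun n => (\int[P]_(w in A n) h1 w + \int[P]_(w in A n) h2 w)%E)).
- apply: nearW => n /=; rewrite /coupling_cost /= unlock.
  apply/andP; split; last by apply: leeD; [exact: le1|exact: le2].
  by apply: adde_ge0; apply: integral_ge0 => w _; rewrite lee_fin powR_ge0.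
- exact: cvg_cst.
- by rewrite -[X in _ --> X](adde0 0%E); exact: cvgeD.
Qed.

(** * Squares with a bump *)

(** The [n]-th bump: a horizontal rectangle of length [2] whose ordinates lie in
    [(1/(n+2), 1/(n+1))]; its right half sticks out of the square [box 1]. *)
Definition bump (R : realType) (n : nat) : set (R * R) :=
  rect 0 2 n.+2%:R^-1 n.+1%:R^-1.

(** The square [(-1, 1) x (-1, 1)] with the [n]-th bump attached. *)
Definition bumped_square (R : realType) (n : nat) : set (R * R) :=
  box 1 `|` bump n.

Lemma bump_itv (R : realType) (n : nat) :
  0 < (n.+2%:R^-1 : R) /\ (n.+2%:R^-1 : R) < n.+1%:R^-1 <= (1 : R).
Proof.
split; first by rewrite invr_gt0 ltr0n.
by rewrite ltf_pV2 ?posrE ?ltr0n// ltr_nat leqnn/= invf_le1 ?ltr0n// ler1n.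
Qed.

Lemma bump_disjoint (R : realType) (n m : nat) :
  n != m -> bump n `&` bump m = set0 :> set (R * R).
Proof.
wlog nm : n m / (n < m)%N => [H|_].
  rewrite neq_ltn => /orP[nm|mn]; first by apply: H => //; rewrite ltn_eqF.
  by rewrite setIC; apply: H => //; rewrite ltn_eqF.
apply/seteqP; split=> // z [[_ _ z2 _] [_ _ _ z3]].
have := lt_trans z2 z3; apply/negP; rewrite -leNgt.
by rewrite lef_pV2 ?posrE ?ltr0n// ler_nat.
Qed.

Lemma box_domain (R : realType) : domain (box 1 : set (R * R)) /\ box 1 (0, 0 : R).
Proof.
have U0 : box 1 (0, 0 : R) by split=> /=; lra.
split=> //; split; first by exists (0, 0).
- exact: rect_connected.
- exact/gauged_open/gauged_rect.
- by apply/eqP => /seteqP[_ /(_ (1, 1) Logic.I)] [/= _]; rewrite ltxx.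
Qed.

Lemma bumped_square_domain (R : realType) (n : nat) :
  domain (@bumped_square R n) /\ bumped_square n (0, 0 : R).
Proof.
have U0 : box 1 (0, 0 : R) by split=> /=; lra.
have [b0 /andP[b1 b2]] := bump_itv R n.
rewrite /bumped_square /bump; move: b0 b1 b2.
move: (n.+2%:R^-1 : R) (n.+1%:R^-1 : R) => a b b0 b1 b2.
split; last by left.
split; first by exists (0, 0); left.
- apply: connectedU; [|exact: rect_connected|exact: rect_connected].
  by exists (1 / 2, (a + b) / 2); split; split=> /=; lra.
- by apply: gauged_open; apply: gaugedU; exact: gauged_rect.
- apply/eqP => /seteqP[_ /(_ (2, 2) Logic.I)] [] [/= _]; rewrite ?ltxx//.
  by move=> + _ _; lra.
Qed.

Lemma closed_half_plane (R : realType) : closed [set z : R * R | z.1 <= 1].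
Proof.
apply: (@closed_comp _ _ (fun z : R * R => z.1) [set x | x <= 1]) => [z _|].
  exact: cvg_fst.
exact: closed_le.
Qed.

(** The tip of the bump is a boundary point. *)
Lemma boundary_bumped_square (R : realType) (n : nat) :
  exists y : R, boundary (@bumped_square R n) (2, y).
Proof.
have [b0 /andP[b1 b2]] := bump_itv R n.
rewrite /bumped_square /bump; move: b0 b1 b2.
move: (n.+2%:R^-1 : R) (n.+1%:R^-1 : R) => a b b0 b1 b2.
pose y : R := (a + b) / 2.
exists y; split; last first.
  by move=> /interior_subset [] [/= _]; rewrite ?ltxx//; lra.
move=> B /= [[B1 B2] [/= nB1 nB2] BB].
have [e /= e0 He] := nB1.
pose x : R := 2 - Num.min 1 (e / 2).
have m0 : 0 < Num.min 1 (e / 2) by rewrite lt_min ltr01 divr_gt0.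
have m1 : Num.min 1 (e / 2) <= 1 by rewrite ge_min lexx.
have m2 : Num.min 1 (e / 2) <= e / 2 by rewrite ge_min lexx orbT.
exists (x, y); split.
  by right; split=> /=; rewrite /x /y; lra.
apply: BB; split=> /=; last exact: nbhs_singleton.
by apply: He; rewrite /ball_/= /x opprB addrC subrK gtr0_norm//; lra.
Qed.

(** The tip has abscissa [2], whereas the square lies in the closed half-plane
    of abscissas at most [1]. *)
Lemma hausdorff_bumped_square (R : realType) (n : nat) :
  (1 <= hausdorff_dist (boundary (@bumped_square R n)) (boundary (box 1)))%E.
Proof.
have [y By] := boundary_bumped_square R n.
rewrite /hausdorff_dist le_max; apply/orP; left.
apply: (@le_trans _ _ (dist_to (2, y) (boundary (box 1)))); last first.
  by apply: ereal_sup_ubound; exists (2, y).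
apply: le_ereal_inf_tmp => _ [z [cz _] <-]; rewrite lee_fin.
have z1 : z.1 <= 1.
  have : closure [set z : R * R | z.1 <= 1] z.
    by apply: closureS cz => u [_ u1 _ _] /=; exact: ltW.
  by rewrite -(closure_id _).1//; exact: closed_half_plane.
rewrite /cmod/=.
rewrite -[leLHS]sqrtr1 ler_sqrt ?ltr01//; last by rewrite addr_ge0 ?sqr_ge0.
have : 1 <= (2 - z.1) ^+ 2 by apply: exprn_ege1; lra.
have : 0 <= (y - z.2) ^+ 2 by rewrite sqr_ge0.
by lra.
Qed.

Theorem theorem7 (R : realType) (p : R) (hp : 0 < p) :
  exists (U : set (R * R)) (U_ : nat -> set (R * R)),
    [/\ domain U /\ U (0, 0),
        forall n, domain (U_ n) /\ U_ n (0, 0),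
        p_brownian_cvg p U_ U &
        ~ (hausdorff_dist (boundary (U_ n)) (boundary U) @[n --> \oo]
           --> 0%E)].
Proof.
exists (box 1), (@bumped_square R); split.
- exact: box_domain.
- exact: bumped_square_domain.
- apply: (@p_brownian_cvg_disjoint R p 3) => //.
  + exact: gauged_rect.
  + by move=> n; apply: gaugedU; exact: gauged_rect.
  + exact: (box_domain R).2.
  + by move=> n z; left.
  + move=> n z; have [b0 /andP[b1 b2]] := bump_itv R n.
    rewrite /bumped_square /bump; move: b0 b1 b2.
    move: (n.+2%:R^-1 : R) (n.+1%:R^-1 : R) => a b b0 b1 b2.
    by case=> -[/= h1 h2 h3 h4]; split; lra.
  + move=> n m nm z [[//|zn] [//|zm]].
    by have : (bump n `&` bump m) z by []; rewrite bump_disjoint.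
- move=> H; suff : (1 <= 0 :> \bar R)%E by rewrite lee_fin ler10.
  by apply: (cvge_to_ge H); apply: nearW => n; exact: hausdorff_bumped_square.
Qed.
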